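(* The following are true: (i) If the uniform probability measure of the $n$-dimensional cube $C_n=[-1/2,1/2]^n$ has the (B)-property for every positive integer $n$, then the log-Brunn-Minkowski inequality $$V(\lambda\cdot K+_o(1-\lambda)\cdot L)\geq V(K)^{\lambda}V(L)^{1-\lambda}$$ holds for all positive integers $n$, for all $\lambda\in(0,1)$, and for all symmetric convex bodies $K, L$ in $\mathbb{R}^n$. (ii) Let $n$ be a positive integer. If the log-Brunn-Minkowski inequality $V(\lambda\cdot K+_o(1-\lambda)\cdot L)\geq V(K)^{\lambda}V(L)^{1-\lambda}$ holds in dimension $n$ (that is, for all $\lambda\in[0,1]$ and all symmetric convex bodies $K,L$ in $\mathbb{R}^n$), then the uniform probability measure of the $n$-dimensional cube $C_n$ has the (B)-property.
   Context: A convex body in $\mathbb{R}^n$ is a compact convex set with non-empty interior; $K$ is symmetric if $K=-K$; $V$ denotes $n$-dimensional volume. The support function of $K$ is $h_K(x)=\max\{x\cdot y : y\in K\}$, and the 0-convex combination is $$\lambda\cdot K+_o(1-\lambda)\cdot L=\{x\in\mathbb{R}^n : x\cdot u\le h_K^{\lambda}(u)h_L^{1-\lambda}(u)\text{ for all }u\in S^{n-1}\}.$$ The uniform probability measure of a symmetric convex body $K$ is $\mu_K(A)=V(K\cap A)/V(K)$. A Borel measure $\mu$ on $\mathbb{R}^n$ has the (B)-property if for any symmetric convex body $K$ in $\mathbb{R}^n$ and any positive numbers $t_1,\dots,t_n$, the function $s\mapsto\mu\big(\mathrm{diag}(t_1^{s},\dots,t_n^{s})K\big)$, $s\in\mathbb{R}$,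 is log-concave, where $\mathrm{diag}(c_1,\dots,c_n)$ is the diagonal matrix with diagonal entries $c_1,\dots,c_n$. *)

(* Defs.v *)
From HB Require Import structures.
From mathcomp Require Import all_boot all_order all_algebra.
From mathcomp Require Import all_classical all_reals all_analysis.
From mathcomp Require Import measurable_realfun.

Set Implicit Arguments.
Unset Strict Implicit.
Unset Printing Implicit Defensive.

Import Order.TTheory GRing.Theory Num.Theory.
Import numFieldNormedType.Exports.

Local Open Scope classical_set_scope.
Local Open Scope ring_scope.

(* R^n is ['rV[R]_n] with the topology of the library, and [borel_rV R n] is
   the same type with the sigma-algebra generated by the open sets. *)
Notation borel_rV R n := (g_sigma_algebraType (@open 'rV[R]_n)).

Lemma measurable_coord_rV (R : realType) n (i : 'I_n) :
  measurable_fun setT (fun v : borel_rV R n => v ord0 i : R).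
Proof.
apply: (measurability _ (RGenOpens.measurableE R)) => _ [_ [a [b ->] <-]].
rewrite setTI; apply: sub_sigma_algebra.
apply: open_comp; last exact: interval_open.
by move=> v _; exact: coord_continuous.
Qed.

Lemma measurable_box_rV (R : realType) n (A : 'I_n -> set R) :
  (forall i, measurable (A i)) ->
  measurable ([set v | forall i, A i (v ord0 i)] : set (borel_rV R n)).
Proof.
move=> mA; rewrite [X in measurable X](_ : _ =
    \bigcap_(i in [set: 'I_n]) [set v : borel_rV R n | A i (v ord0 i)]).
  apply: fin_bigcap_measurable; first exact: finite_finset.
  by move=> i _; rewrite -[X in measurable X]setTI; exact: measurable_coord_rV.
by apply/seteqP; split => v /= Av i; [move=> _|]; exact: Av.
Qed.

Lemma open_rV_bigcup (R : realType) n (O : set 'rV[R]_n) : open O ->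
  let box (p : 'rV[rat]_n * 'rV[rat]_n) := [set v : 'rV[R]_n |
    forall i, v ord0 i \in `]ratr (p.1 ord0 i), ratr (p.2 ord0 i)[] in
  O = \bigcup_(p in [set p | box p `<=` O]) box p.
Proof.
move=> oO box; apply/seteqP; split; last by move=> x [p /= pO /pO].
move=> x Ox; have /nbhs_ballP[e /= e0 eO] : nbhs x O by exact: open_nbhs_nbhs.
have /choice[a aP] (i : 'I_n) :
    exists q, ratr q \in `](x ord0 i - e), (x ord0 i)[.
  by apply: rat_in_itvoo; rewrite ltrBlDr ltrDl.
have /choice[b bP] (i : 'I_n) :
    exists q, ratr q \in `](x ord0 i), (x ord0 i + e)[.
  by apply: rat_in_itvoo; rewrite ltrDl.
exists (\row_i a i, \row_i b i); last first.
  move=> i /=; rewrite !mxE in_itv/=.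
  by move: (aP i) (bP i); rewrite !in_itv/= => /andP[_ ->] /andP[-> _].
move=> v /= abv; apply: eO; split => // i j; rewrite (ord1 i) /ball/=.
move: (aP j) (bP j) (abv j); rewrite !mxE !in_itv/=.
move=> /andP[aj _] /andP[_ bj] /andP[vj1 vj2].
rewrite ltr_distlC; apply/andP; split.
- exact: (lt_trans aj).
- exact: (lt_trans vj2).
Qed.

Lemma measurable_fun_rV (R : realType) n d (T : measurableType d)
    (f : T -> borel_rV R n) :
  (forall i, measurable_fun setT (fun x => f x ord0 i : R)) ->
  measurable_fun setT f.
Proof.
move=> mf; apply: (@measurability _ _ _ (borel_rV R n) _ _ (@open 'rV[R]_n)) =>
  // _ [U oU <-].
rewrite setTI (open_rV_bigcup oU) preimage_bigcup bigcup_mkcond.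
apply: countable_bigcupT_measurable => [|p]; first exact: countableP.
case: ifPn => // _; rewrite [X in measurable X](_ : _ =
    \bigcap_(i in [set: 'I_n]) ((fun x => f x ord0 i : R) @^-1`
      `]ratr (p.1 ord0 i), ratr (p.2 ord0 i)[)).
  apply: fin_bigcap_measurable; first exact: finite_finset.
  by move=> i _; rewrite -[X in measurable X]setTI; apply: mf.
by apply/seteqP; split => v /= Av i; [move=> _|]; exact: Av.
Qed.

Definition cons_rV (R : realType) n (p : measurableTypeR R * borel_rV R n) :
  borel_rV R n.+1 := row_mx (p.1%:M : 'rV[R]_1) (p.2 : 'rV[R]_n).

Lemma cons_rV0 (R : realType) n (p : measurableTypeR R * borel_rV R n) :
  cons_rV p ord0 ord0 = p.1.
Proof.
have -> : ord0 = lshift n (ord0 : 'I_1) by exact: val_inj.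
by rewrite [LHS](row_mxEl (p.1%:M : 'rV[R]_1)) mxE mulr1n.
Qed.

Lemma cons_rVS (R : realType) n (p : measurableTypeR R * borel_rV R n) i :
  cons_rV p ord0 (lift ord0 i) = p.2 ord0 i.
Proof.
have -> : lift ord0 i = rshift 1 i by exact: val_inj.
exact: (row_mxEr (p.1%:M : 'rV[R]_1)).
Qed.

Lemma measurable_cons_rV (R : realType) n :
  measurable_fun setT (@cons_rV R n).
Proof.
apply: measurable_fun_rV => i; case: (unliftP ord0 i) => [j|] ->.
  under eq_fun do rewrite cons_rVS.
  exact: (measurableT_comp (measurable_coord_rV j) measurable_snd).
under eq_fun do rewrite cons_rV0.
exact: measurable_fst.
Qed.

Definition uncons_rV (R : realType) n (v : borel_rV R n.+1) :
    measurableTypeR R * borel_rV R n :=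
  (v ord0 ord0, \row_i v ord0 (lift ord0 i)).

Lemma measurable_uncons_rV (R : realType) n :
  measurable_fun setT (@uncons_rV R n).
Proof.
apply: measurable_fun_pair; first exact: measurable_coord_rV.
apply: measurable_fun_rV => i; under eq_fun do rewrite mxE.
exact: measurable_coord_rV.
Qed.

Lemma cons_rVK (R : realType) n : cancel (@cons_rV R n) (@uncons_rV R n).
Proof.
move=> [x v]; rewrite /uncons_rV cons_rV0; congr pair.
by apply/rowP => i; rewrite mxE cons_rVS.
Qed.

Section lebesgue_rV_step.
Context (R : realType) (n : nat).
Variable m : {sigma_finite_measure set (borel_rV R n) -> \bar R}.

Definition cons_measure : set (borel_rV R n.+1) -> \bar R :=
  pushforward (lebesgue_measure \x m)%E (@cons_rV R n).

Let preimage_cons_measurable A : measurable A ->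
  measurable (@cons_rV R n @^-1` A).
Proof.
by move=> mA; rewrite -[X in measurable X]setTI; exact: measurable_cons_rV.
Qed.

Let cons_measure0 : cons_measure set0 = 0%E.
Proof. by rewrite /cons_measure /pushforward preimage_set0 measure0. Qed.

Let cons_measure_ge0 A : (0 <= cons_measure A)%E.
Proof. exact: (measure_ge0 (lebesgue_measure \x m)%E). Qed.

Let cons_measure_sigma_additive : semi_sigma_additive cons_measure.
Proof.
move=> F mF tF mUF; rewrite /cons_measure /pushforward preimage_bigcup.
apply: measure_semi_sigma_additive.
- by move=> i; exact: preimage_cons_measurable.
- apply/trivIsetP => i j _ _ ij; rewrite -preimage_setI.
  by move/trivIsetP : tF => /(_ _ _ _ _ ij) ->//; rewrite preimage_set0.
- by rewrite -preimage_bigcup; exact: preimage_cons_measurable.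
Qed.

HB.instance Definition _ := isMeasure.Build _ _ _ cons_measure
  cons_measure0 cons_measure_ge0 cons_measure_sigma_additive.

Let cons_measure_sigma_finite : sigma_finite setT cons_measure.
Proof.
have /sigma_finiteP[F [UF ndF mF]] := sigma_finiteT (@lebesgue_measure R).
have /sigma_finiteP[G [UG ndG mG]] := sigma_finiteT m.
exists (fun i => @uncons_rV R n @^-1` (F i `*` G i)).
  rewrite -preimage_bigcup (_ : \bigcup_i _ = setT) ?preimage_setT//.
  rewrite -setXTT UF UG; apply/seteqP; split.
    by move=> [x v] [i _ [/= Fx Gv]]; split; exists i.
  move=> [x v] [/= [i _ Fx] [j _ Gv]]; exists (maxn i j) => //; split.
  - by move: x Fx; exact/subsetPset/ndF/leq_maxl.
  - by move: v Gv; exact/subsetPset/ndG/leq_maxr.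
move=> i; have [mFi Foo] := mF i; have [mGi Goo] := mG i; split.
  rewrite -[X in measurable X]setTI.
  by apply: measurable_uncons_rV => //; exact: measurableX.
rewrite /cons_measure /pushforward -comp_preimage.
rewrite (_ : _ \o _ = id) ?preimage_id; last exact/funext/cons_rVK.
by rewrite product_measure1E// lte_mul_pinfty// ge0_fin_numE.
Qed.

HB.instance Definition _ :=
  Measure_isSigmaFinite.Build _ _ _ cons_measure cons_measure_sigma_finite.

End lebesgue_rV_step.

(* n-dimensional volume as the n-fold product of [lebesgue_measure], transported
   from R * R^n to R^(n+1) by [cons_rV]; see [lebesgue_rV_box]. *)
Fixpoint lebesgue_rV (R : realType) (n : nat) :
    {sigma_finite_measure set (borel_rV R n) -> \bar R} :=
  match n with
  | 0 => \d_((0 : 'rV[R]_0) : borel_rV R 0)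
  | n'.+1 => cons_measure (lebesgue_rV R n')
  end.

Lemma lebesgue_rV_box (R : realType) n (A : 'I_n -> set R) :
  (forall i, measurable (A i)) ->
  lebesgue_rV R n [set v | forall i, A i (v ord0 i)] =
  (\prod_(i < n) lebesgue_measure (A i))%E.
Proof.
elim: n A => [|n IHn] A mA.
  rewrite big_ord0 /= diracE mem_set // => i.
  by have := ltn_ord i.
have mA' i : measurable (A (lift ord0 i)) by [].
have mB := measurable_box_rV mA'.
rewrite big_ord_recl -(IHn _ mA').
rewrite -(product_measure1E lebesgue_measure _ (mA ord0) mB).
rewrite /= /cons_measure /pushforward; congr product_measure1.
apply/seteqP; split => [[x v]/= Av|[x v]/= [Ax Av] i].
  split; first by have := Av ord0; rewrite cons_rV0.
  by move=> i; have := Av (lift ord0 i); rewrite cons_rVS.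
by case: (unliftP ord0 i) => [j|] ->; rewrite ?cons_rVS ?cons_rV0//; exact: Av.
Qed.

(* [l] ranges over the open interval because [poweR] has 0 `^ 0 = 1. *)
Definition log_concave (R : realType) (f : R -> \bar R) : Prop :=
  forall (a b l : R), 0 < l < 1 ->
    (f a `^ l%R * f b `^ (1 - l)%R <= f (l * a + (1 - l) * b)%R)%E.

(* The norm [`|x|] of the library on row vectors is the sup norm, hence the
   explicit Euclidean norm. *)
Definition dotv (R : realType) n (x y : 'rV[R]_n) : R :=
  \sum_(i < n) x ord0 i * y ord0 i.

Definition sphere (R : realType) n : set 'rV[R]_n :=
  [set u | Num.sqrt (dotv u u) = 1].

Definition convex_body (R : realType) n (K : set 'rV[R]_n) : Prop :=
  [/\ compact K, convex_set (K : set (convex_lmodType 'rV[R]_n)) &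
      K° !=set0].

Definition symmetric_convex_body (R : realType) n (K : set 'rV[R]_n) : Prop :=
  convex_body K /\ K = [set - x | x in K].

(* a maximum when [K] is compact and nonempty *)
Definition support_fun (R : realType) n (K : set 'rV[R]_n) (x : 'rV[R]_n) : R :=
  sup [set dotv x y | y in K].

Definition log_comb (R : realType) n (l : R) (K L : set 'rV[R]_n) :
    set 'rV[R]_n :=
  [set x | forall u, sphere u ->
     dotv x u <= support_fun K u `^ l * support_fun L u `^ (1 - l)].

Definition log_Brunn_Minkowski (R : realType) n (l : R) (K L : set 'rV[R]_n) :
    Prop :=
  (lebesgue_rV R n K `^ l%R * lebesgue_rV R n L `^ (1 - l)%R <=
   lebesgue_rV R n (log_comb l K L))%E.

Definition diag_image (R : realType) n (c : 'I_n -> R) (K : set 'rV[R]_n) :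
    set 'rV[R]_n :=
  [set x *m diag_mx (\row_i c i) | x in K].

Definition B_property (R : realType) n
    (mu : {measure set (borel_rV R n) -> \bar R}) : Prop :=
  forall (K : set 'rV[R]_n) (t : 'I_n -> R), symmetric_convex_body K ->
    (forall i, 0 < t i) ->
    log_concave (fun s => mu (diag_image (fun i => t i `^ s) K)).

Section uniform_measure.
Context (R : realType) (n : nat) (K : set (borel_rV R n)).
Local Open Scope ereal_scope.

Definition uniform_measure (mK : measurable K) : set (borel_rV R n) -> \bar R :=
  fun A => lebesgue_rV R n (K `&` A) / lebesgue_rV R n K.

Variable mK : measurable K.

Let uniform_measure0 : uniform_measure mK set0 = 0.
Proof. by rewrite /uniform_measure setI0 measure0 mul0e. Qed.

Let uniform_measure_ge0 A : 0 <= uniform_measure mK A.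
Proof. by rewrite /uniform_measure mule_ge0// inve_ge0. Qed.

Let uniform_measure_sigma_additive : semi_sigma_additive (uniform_measure mK).
Proof.
have [K0|K0] := eqVneq (lebesgue_rV R n K) 0.
  have U0 A : measurable A -> uniform_measure mK A = 0.
    move=> mA; rewrite /uniform_measure (_ : lebesgue_rV R n _ = 0) ?mul0e//.
    apply/eqP; rewrite eq_le measure_ge0 andbT -[leRHS]K0.
    have mKA : measurable (K `&` A) by exact: measurableI.
    by apply: le_measure; rewrite ?inE//; exact: subIsetl.
  move=> F mF tF mUF; rewrite U0//.
  rewrite (_ : (fun _ => _) = cst 0); first exact: cvg_cst.
  by apply/funext => i; rewrite big1// => j _; exact: U0.
have [c ->] : exists c : {nonneg R},
    uniform_measure mK = mscale c (mrestr (lebesgue_rV R n) mK).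
  rewrite /uniform_measure /mscale /mrestr.
  have : 0 <= lebesgue_rV R n K by exact: measure_ge0.
  move: K0.
  case: (lebesgue_rV R n K) => [r| |]//; rewrite ?eqe => r0 r_ge0.
    have rV_ge0 : (0 <= r^-1)%R by rewrite invr_ge0 -lee_fin.
    exists (NngNum rV_ge0); apply/funext => A /=.
    by rewrite inver (negPf r0) muleC setIC.
  by exists 0%:nng%R; apply/funext => A /=; rewrite invey mule0 mul0e.
exact: measure_semi_sigma_additive.
Qed.

HB.instance Definition _ := isMeasure.Build _ _ _ (uniform_measure mK)
  uniform_measure0 uniform_measure_ge0 uniform_measure_sigma_additive.

End uniform_measure.

Definition cube (R : realType) n : set (borel_rV R n) :=
  [set x | forall i, x ord0 i \in `[- 2^-1, 2^-1]].
Arguments cube : clear implicits.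

Lemma measurable_cube (R : realType) n : measurable (cube R n).
Proof. by apply: (@measurable_box_rV _ _ (fun=> `[- 2^-1, 2^-1]%classic)). Qed.
Arguments measurable_cube : clear implicits.

(* Main.v *)
Require Import Defs.
From mathcomp Require Import all_boot all_order all_algebra.
From mathcomp Require Import all_classical all_reals all_analysis.
From mathcomp Require Import measurable_realfun ring lra.

Set Implicit Arguments.
Unset Strict Implicit.
Unset Printing Implicit Defensive.

Import Order.TTheory GRing.Theory Num.Theory.
Import numFieldNormedType.Exports.

Local Open Scope classical_set_scope.
Local Open Scope ring_scope.

(** The cube is a box and volume scales under diagonal matrices, so, up to
determinants that are log-linear in [s], the function
[s |-> mu (diag (t_1^s, ..., t_n^s) K)] is the volume of the intersection of
[K] with a box whose half-widths run along a geometric progression. Hence the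
(B)-property of the cube says that
[V (K /\ box a) ^ l * V (K /\ box b) ^ (1 - l) <= V (K /\ box g)]
where [g i = a i ^ l * b i ^ (1 - l)] is the weighted geometric mean
([B_property_cubeP], [box_log_concave]). Both implications are proved for this
box inequality.

From log-Brunn-Minkowski to boxes: the logarithmic combination of [K /\ box a]
and [K /\ box b] lies in [K /\ box g]. The coordinate directions bound it by
the box; in any other direction both support functions are at most that of
[K], hence so is their geometric mean, and [K] is the intersection of its
supporting half-spaces ([log_comb_setI_box], [separation]).

From boxes in all dimensions to log-Brunn-Minkowski: a slab [|x . u| <= c] cut
out of a body [K] of dimension [n] is the limit, as [eps] tends to [0], of a box
constraint on the body of dimension [n + 1] made of the points [(y, x)] with
[x] in [K] and [|y - x . u| <= eps]: by Fubini, restricting that body to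
[|y| <= c] gives [2 eps] times the volume of [K] cut by a slab whose width is
[c] up to [eps]. Therefore the box inequality in all dimensions also holds with
finitely many slabs in arbitrary directions, their widths being interpolated
geometrically ([cut_log_concave_all]). Cutting a big box by slabs whose widths
are the support functions of [K] and of [L], in more and more rational
directions, gives polytopes containing [K] and [L] on the left-hand side, and
on the right-hand side polytopes that decrease to a subset of the logarithmic
combination ([log_BM_of_cut_log_concave]). *)

(** * The scalar product and the topology of row vectors *)

Section dot_product.
Context (R : realType) (n : nat).
Implicit Types x y u : 'rV[R]_n.

Lemma dotvC x y : dotv x y = dotv y x.
Proof. by apply: eq_bigr => i _; rewrite mulrC. Qed.

Lemma dotvDl x y u : dotv (x + y) u = dotv x u + dotv y u.
Proof. by rewrite -big_split; apply: eq_bigr => i _; rewrite mxE mulrDl. Qed.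

Lemma dotvZl t x u : dotv (t *: x) u = t * dotv x u.
Proof. by rewrite mulr_sumr; apply: eq_bigr => i _; rewrite mxE mulrA. Qed.

Lemma dotvDr x y u : dotv u (x + y) = dotv u x + dotv u y.
Proof. by rewrite dotvC dotvDl !(dotvC u). Qed.

Lemma dotvZr t x u : dotv u (t *: x) = t * dotv u x.
Proof. by rewrite dotvC dotvZl (dotvC u). Qed.

Lemma dotv_sqrD x y t : dotv (x + t *: y) (x + t *: y) =
  dotv x x + 2 * t * dotv y x + t * t * dotv y y.
Proof. by rewrite !(dotvDl, dotvDr, dotvZl, dotvZr) (dotvC x y); ring. Qed.

Lemma dotvNl x u : dotv (- x) u = - dotv x u.
Proof. by rewrite -scaleN1r dotvZl mulN1r. Qed.

Lemma dotvNr x u : dotv x (- u) = - dotv x u.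
Proof. by rewrite dotvC dotvNl dotvC. Qed.

Lemma dotv0 x : dotv x 0 = 0.
Proof. by rewrite /dotv big1// => i _; rewrite mxE mulr0. Qed.

Lemma dotv_delta x i : dotv x (delta_mx ord0 i) = x ord0 i.
Proof.
rewrite /dotv (bigD1 i)//= big1 ?addr0; first by rewrite mxE !eqxx mulr1.
by move=> j ji; rewrite mxE (negPf ji) andbF mulr0.
Qed.

Lemma dotvv_gt0 u : u != 0 -> 0 < dotv u u.
Proof.
move=> u0; have sq_ge0 i : 0 <= u ord0 i * u ord0 i by rewrite -expr2 sqr_ge0.
rewrite lt_neqAle sumr_ge0// andbT; apply: contra u0 => /eqP uu0.
apply/eqP/rowP => i; rewrite mxE; apply/eqP.
have := psumr_eq0P (fun i _ => sq_ge0 i) (esym uu0) (i := i) isT.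
by move/eqP; rewrite mulf_eq0 orbb.
Qed.

Lemma continuous_rV (T : topologicalType) (f : T -> 'rV[R]_n) :
  (forall i, continuous (fun x : T => f x ord0 i)) -> continuous f.
Proof.
move=> cf x A [P Px PA].
have : \forall y \near x, forall i, P ord0 i (f y ord0 i).
  by apply: filter_forall => i; apply: cf; exact: Px.
by apply: filterS => y Py; apply: PA => i j; rewrite (ord1 i).
Qed.

Lemma continuous_dotv u : continuous (fun x => dotv x u).
Proof.
rewrite /dotv; apply: continuous_big => [|i _ x].
  by move=> z; exact: add_continuous.
apply: continuousM; [exact: coord_continuous|exact: cst_continuous].
Qed.

End dot_product.

(** * Closed sets and symmetric convex bodies *)

Definition box (R : realType) n (a : 'I_n -> R) : set 'rV[R]_n :=
  [set x | forall i, `|x ord0 i| <= a i].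

Definition slab (R : realType) n (u : 'rV[R]_n) (c : R) : set 'rV[R]_n :=
  [set x | `|dotv x u| <= c].

Definition stretch (R : realType) n (c : 'I_n -> R) (x : 'rV[R]_n) :
  'rV[R]_n := \row_i (c i * x ord0 i).

Section closed_sets.
Context (R : realType) (n : nat).

Lemma closed_measurable_rV (A : set 'rV[R]_n) :
  closed A -> measurable (A : set (borel_rV R n)).
Proof.
move=> cA; rewrite -[A]setCK; apply: measurableC; apply: sub_sigma_algebra.
exact: closed_openC.
Qed.

Lemma closed_preimage (T U : topologicalType) (f : T -> U) (D : set U) :
  continuous f -> closed D -> closed (f @^-1` D).
Proof. by move=> cf; apply: preimage_closed => x _; exact: cf. Qed.

Lemma closed_abs_le (T : topologicalType) (f : T -> R) (c : R) :
  continuous f -> closed [set x | `|f x| <= c].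
Proof.
move=> cf; apply: (@closed_preimage _ _ (fun x => `|f x|) [set y | y <= c]).
  by move=> x; apply: continuous_comp; [exact: cf|exact: norm_continuous].
exact: closed_le.
Qed.

Lemma closed_forall (T : topologicalType) (I : Type) (P : I -> set T) :
  (forall i, closed (P i)) -> closed [set x | forall i, P i x].
Proof.
move=> cP; rewrite [X in closed X](_ : _ = \bigcap_(i in setT) P i).
  by apply: closed_bigI => i _.
by apply/seteqP; split => x /= Px i; [move=> _|]; exact: Px.
Qed.

Lemma closed_box (a : 'I_n -> R) : closed (box a).
Proof.
by apply: closed_forall => i; apply: closed_abs_le; exact: coord_continuous.
Qed.

Lemma closed_slab (u : 'rV[R]_n) c : closed (slab u c).
Proof. by apply: closed_abs_le; exact: continuous_dotv. Qed.

Lemma continuous_stretch (c : 'I_n -> R) : continuous (stretch c).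
Proof.
apply: continuous_rV => i x; under eq_fun do rewrite mxE.
apply: continuousM; [exact: cst_continuous|exact: coord_continuous].
Qed.

Lemma le_coord_norm (x : 'rV[R]_n) i : `|x ord0 i| <= `|x|.
Proof.
have /mapP[j _ ->] : `|x ord0 i| \in [seq `|x k.1 k.2| | k : 'I_1 * 'I_n].
  by apply/mapP; exists (ord0, i) => //=; rewrite mem_enum.
rewrite [leRHS]/Num.norm/= mx_normrE; apply/bigmax_geP; right => /=.
by exists j.
Qed.

Lemma compact_subbox (K : set 'rV[R]_n) :
  compact K -> exists2 B, 0 < B & K `<=` box (fun=> B).
Proof.
move=> /compact_bounded/ex_strict_bound_gt0[B B0 KB]; exists B => // x Kx i.
by apply: (le_trans (le_coord_norm x i)); apply/ltW/KB.
Qed.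

Lemma box_compact (a : 'I_n -> R) : compact (box a).
Proof.
have := @rV_compact _ n (fun i => `[- a i, a i]%classic)
  (fun i => @segment_compact _ _ _).
congr compact; apply/seteqP; split => x /= xa i; have := xa i.
  by rewrite in_itv/= ler_norml.
by rewrite in_itv/= ler_norml.
Qed.

(** The description used below to build bodies. The last condition comes from a
small box around an interior point [p]: it contains [p + x] and [p - x] for
small [x], and [x] is the midpoint of [p + x] and [- (p - x)]. *)
Lemma symmetric_convex_bodyP (K : set 'rV[R]_n) :
  symmetric_convex_body K <->
  [/\ closed K, exists2 B, 0 < B & K `<=` box (fun=> B),
      forall x y t, 0 <= t <= 1 -> K x -> K y -> K (t *: x + (1 - t) *: y),
      forall x, K x -> K (- x) &
      exists2 r, 0 < r & box (fun=> r) `<=` K].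
Proof.
split=> [[[cK convK [p /= Kp]] symK]|[cK [B B0 KB] convK symK [r r0 rK]]].
  have convK' x y t : 0 <= t <= 1 -> K x -> K y -> K (t *: x + (1 - t) *: y).
    move=> /andP[t0 t1] Kx Ky.
    have tI : Itv.spec (@Itv.num_sem R) (Itv.Real `[0%Z, 1%Z]) t.
      apply/andP; split; first exact: ger0_real.
      by rewrite /= in_itv/= t0 t1.
    by have /set_mem := convK x y (Itv.mk tI) (mem_set Kx) (mem_set Ky).
  have symK' x : K x -> K (- x) by move=> Kx; rewrite symK; exists x.
  split => //.
  - exact: compact_closed.
  - exact: compact_subbox.
  have /nbhs_ballP[e /= e0 eK] := Kp.
  exists (e / 2); first by rewrite divr_gt0.
  move=> x xe.
  have peK (y : 'rV[R]_n) : (forall i, `|y ord0 i| <= e / 2) -> K (p + y).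
    move=> ye; apply: eK; split => // i j; rewrite (ord1 i) /ball/= mxE.
    rewrite opprD addrA subrr add0r normrN (le_lt_trans (ye j))//.
    by rewrite ltr_pdivrMr// ltr_pMr// ltr1n.
  have -> : x = 2^-1 *: (p + x) + (1 - 2^-1) *: (- (p - x)).
    by apply/rowP => i; rewrite !mxE; field.
  apply: convK'.
  - by apply/andP; split; lra.
  - by apply: peK.
  - by apply/symK'/peK => i; rewrite mxE normrN.
split.
  split.
  - by apply: (subclosed_compact cK _ KB); exact: box_compact.
  - move=> x y t /set_mem Kx /set_mem Ky; apply/mem_set.
    by apply: convK => //; apply/andP; split; [exact: ge0|exact: le1].
  - exists 0; apply/nbhs_ballP; exists r => //= x [_ xr]; apply: rK => i.
    by have := xr ord0 i; rewrite /ball/= !mxE sub0r normrN => /ltW.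
apply/seteqP; split => [x Kx|_ [x Kx <-]]; last exact: symK.
by exists (- x); [exact: symK|rewrite opprK].
Qed.

End closed_sets.


(** * Scaling of volume *)

Section scaling.
Context (R : realType).

Lemma lebesgue_measure_scale (c : R) (A : set (measurableTypeR R)) : 0 < c ->
  measurable A ->
  (c%:E * lebesgue_measure (( *%R c) @^-1` A) = lebesgue_measure A)%E.
Proof.
move=> c0 mA.
have mc : measurable_fun [set: measurableTypeR R]
    (( *%R c) : measurableTypeR R -> measurableTypeR R).
  exact: measurable_funM.
pose m : {measure set measurableTypeR R -> \bar R} :=
  mscale (NngNum (ltW c0)) (pushforward lebesgue_measure
    (( *%R c) : measurableTypeR R -> measurableTypeR R)).
have mE B : m mc B = (c%:E * lebesgue_measure (( *%R c) @^-1` B))%E by [].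
rewrite -[LHS]mE; apply/esym/lebesgue_measure_unique => // _ [[a b] _ <-].
rewrite mE.
have -> : ( *%R c) @^-1` `]a, b]%classic = `](a / c), (b / c)]%classic.
  apply/seteqP; split => x /=; rewrite !in_itv/= ltr_pdivrMr// ler_pdivlMr//;
    by rewrite mulrC.
rewrite !lebesgue_measure_itv/= !lte_fin ltr_pM2r ?invr_gt0//.
case: ifPn => _; last by rewrite mule0.
by rewrite -!EFinB -EFinM -mulrBl mulrCA divff ?mulr1// gt_eqF.
Qed.

Lemma measurable_stretch n (c : 'I_n -> R) :
  measurable_fun setT (stretch c : borel_rV R n -> borel_rV R n).
Proof.
apply: measurable_fun_rV => i; under eq_fun do rewrite mxE.
by apply: measurable_funM => //; exact: measurable_coord_rV.
Qed.

(** Volume is built one coordinate at a time as a product measure, so the scaled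
preimage measure is compared with it on rectangles only, where the one
dimensional scaling and the induction hypothesis apply. *)
Lemma lebesgue_rV_stretch n (c : 'I_n -> R) (A : set (borel_rV R n)) :
  (forall i, 0 < c i) -> measurable A ->
  ((\prod_(i < n) c i)%:E * lebesgue_rV R n (stretch c @^-1` A) =
   lebesgue_rV R n A)%E.
Proof.
elim: n c A => [c A _ _|n IHn c A c0 mA].
  rewrite big_ord0 mul1e; congr (lebesgue_rV R 0 _).
  by apply/seteqP; split => x /=; congr (A _); apply/rowP => -[].
pose c' i := c (lift ord0 i).
have c'0 i : 0 < c' i by exact: c0.
pose f (p : measurableTypeR R * borel_rV R n) :
    measurableTypeR R * borel_rV R n := (c ord0 * p.1, stretch c' p.2).
have mf : measurable_fun setT f.
  apply: measurable_fun_pair.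
    by apply: measurable_funM => //; exact: measurable_fst.
  exact: (measurableT_comp (measurable_stretch c') measurable_snd).
have P0 : 0 < \prod_(i < n.+1) c i by apply: prodr_gt0.
pose m : {measure set (measurableTypeR R * borel_rV R n) -> \bar R} :=
  mscale (NngNum (ltW P0))
    (pushforward (lebesgue_measure \x lebesgue_rV R n)%E f).
rewrite /= /cons_measure /pushforward.
have -> : @cons_rV R n @^-1` (stretch c @^-1` A) =
    f @^-1` (@cons_rV R n @^-1` A).
  apply/funext => p; congr (A _); apply/rowP => i; rewrite [LHS]mxE.
  case: (unliftP ord0 i) => [j|] ->; last by rewrite !cons_rV0.
  by rewrite !cons_rVS [RHS]mxE.
have mcA : measurable (@cons_rV R n @^-1` A).
  by rewrite -[X in measurable X]setTI; exact: measurable_cons_rV.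
transitivity (m mf (@cons_rV R n @^-1` A)); first by [].
apply/esym; apply: product_measure_unique => // X Y mX mY.
rewrite /m /= /mscale /= /pushforward.
have -> : f @^-1` (X `*` Y) =
    (( *%R (c ord0)) @^-1` X) `*` (stretch c' @^-1` Y).
  by [].
have mcX : measurable (( *%R (c ord0)) @^-1` X : set (measurableTypeR R)).
  rewrite -[X in measurable X]setTI.
  have : measurable_fun [set: measurableTypeR R]
    (( *%R (c ord0)) : measurableTypeR R -> measurableTypeR R).
    exact: measurable_funM.
  by apply.
have mcY : measurable (stretch c' @^-1` Y : set (borel_rV R n)).
  by rewrite -[X in measurable X]setTI; exact: measurable_stretch.
rewrite product_measure1E// big_ord_recl EFinM.
by rewrite muleACA lebesgue_measure_scale// IHn.
Qed.

End scaling.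


(** * Fubini for a thickened graph *)

Definition tail (R : realType) n (z : 'rV[R]_n.+1) : 'rV[R]_n :=
  \row_i z ord0 (lift ord0 i).

(** The graph of a linear form has empty interior; the thickening turns it into
a body when [A] is one. *)
Definition thick_graph (R : realType) n (A : set 'rV[R]_n) (u : 'rV[R]_n)
    (eps : R) :
    set 'rV[R]_n.+1 :=
  [set z | A (tail z) /\ `|z ord0 ord0 - dotv (tail z) u| <= eps].

Section thick_graphs.
Context (R : realType) (n : nat).
Implicit Types (A : set 'rV[R]_n) (u : 'rV[R]_n).

Lemma tail_cons (y : measurableTypeR R) (x : borel_rV R n) :
  tail (cons_rV (y, x)) = x.
Proof. by apply/rowP => i; rewrite mxE cons_rVS. Qed.

Lemma continuous_tail : continuous (@tail R n).
Proof.
apply: continuous_rV => i x; under eq_fun do rewrite mxE.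
exact: coord_continuous.
Qed.

Lemma closed_thick_graph A u eps : closed A -> closed (thick_graph A u eps).
Proof.
move=> cA; apply: closedI.
  by apply: closed_preimage => //; exact: continuous_tail.
apply: closed_abs_le => z.
apply: (@continuousB _ _ _ (fun z : 'rV[R]_n.+1 => z ord0 ord0)
  (fun z => dotv (tail z) u)); first exact: coord_continuous.
apply: (@continuous_comp _ _ _ (@tail R n) (fun x => dotv x u)).
  exact: continuous_tail.
exact: continuous_dotv.
Qed.

(** The volume in dimension [n + 1] integrates over the first coordinate last;
this is the other order of integration. *)
Lemma lebesgue_rV_section (S : set (borel_rV R n.+1)) : measurable S ->
  lebesgue_rV R n.+1 S = (\int[lebesgue_rV R n]_x
    lebesgue_measure [set y : measurableTypeR R | S (cons_rV (y, x))])%E.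
Proof.
move=> mS.
have mcS : measurable (@cons_rV R n @^-1` S).
  by rewrite -[X in measurable X]setTI; exact: measurable_cons_rV.
transitivity ((lebesgue_measure \x^ lebesgue_rV R n)%E (@cons_rV R n @^-1` S)).
  rewrite /= /cons_measure /pushforward.
  by apply: product_measure_unique => // *; rewrite /= product_measure2E.
by apply: eq_integral => x _ /=; rewrite ysectionE.
Qed.

Lemma measurable_fun_section (S : set (borel_rV R n.+1)) : measurable S ->
  measurable_fun setT (fun x : borel_rV R n =>
    lebesgue_measure [set y : measurableTypeR R | S (cons_rV (y, x))]).
Proof.
move=> mS.
have mcS : measurable (@cons_rV R n @^-1` S).
  by rewrite -[X in measurable X]setTI; exact: measurable_cons_rV.
have := @measurable_fun_ysection _ _ _ _ R lebesgue_measure _ mcS.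
by apply: eq_measurable_fun => x _ /=; rewrite ysectionE.
Qed.

Lemma measurable_section (S : set (borel_rV R n.+1)) x : measurable S ->
  measurable [set y : measurableTypeR R | S (cons_rV (y, x : borel_rV R n))].
Proof.
move=> mS; have mcS : measurable (@cons_rV R n @^-1` S).
  by rewrite -[X in measurable X]setTI; exact: measurable_cons_rV.
by have := measurable_ysection x mcS; rewrite ysectionE.
Qed.

Lemma measurable_abs_le (c e : R) :
  measurable [set y : measurableTypeR R | `|y - c| <= e].
Proof.
rewrite (_ : [set y | _] = `[c - e, c + e]%classic) //.
by apply/seteqP; split => y /=; rewrite in_itv/= ler_distl.
Qed.

Lemma lebesgue_measure_abs_le (c e : R) : 0 <= e ->
  lebesgue_measure [set y : measurableTypeR R | `|y - c| <= e] = (2 * e)%:E.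
Proof.
move=> e0; rewrite (_ : [set y | _] = `[c - e, c + e]%classic).
  rewrite lebesgue_measure_itv/= lte_fin.
  case: ifPn => [_|]; first by rewrite -EFinB; congr EFin; ring.
  rewrite -leNgt => ce; have -> : e = 0 by lra.
  by rewrite mulr0.
by apply/seteqP; split => y /=; rewrite in_itv/= ler_distl.
Qed.

Lemma integral_cst_indic (A : set (borel_rV R n)) (c : R) :
  measurable A -> 0 <= c ->
  (\int[lebesgue_rV R n]_x (c%:E * (\1_A x)%:E) = c%:E * lebesgue_rV R n A)%E.
Proof.
move=> mA c0; rewrite ge0_integralZl//; last first.
  exact/measurable_EFinP.
by rewrite integral_indic// setIT.
Qed.

(** The section over [x] lies in an interval of length [2 eps], and it is empty
unless [x . u] is within [eps] of some [y] with [|y| <= c]. *)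
Lemma lebesgue_rV_thick_graph_le A u (eps c : R) : closed A -> 0 <= eps ->
  (lebesgue_rV R n.+1
     (thick_graph A u eps `&`
      [set z : 'rV[R]_n.+1 | (`|z ord0 ord0| <= c)%R]) <=
   (2 * eps)%:E * lebesgue_rV R n (A `&` slab u (c + eps)))%E.
Proof.
move=> cA eps0.
have mA : measurable (A `&` slab u (c + eps) : set (borel_rV R n)).
  by apply: closed_measurable_rV; apply: closedI => //; exact: closed_slab.
have mS : measurable (thick_graph A u eps `&`
    [set z : 'rV[R]_n.+1 | (`|z ord0 ord0| <= c)%R] : set (borel_rV R n.+1)).
  apply: closed_measurable_rV; apply: closedI; first exact: closed_thick_graph.
  by apply: closed_abs_le; exact: coord_continuous.
have e2 : 0 <= 2 * eps by rewrite mulr_ge0.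
rewrite lebesgue_rV_section// -(integral_cst_indic mA)//.
apply: ge0_le_integral => //.
- exact: measurable_fun_section.
- by apply: emeasurable_funM => //; exact/measurable_EFinP.
move=> x _; rewrite indicE; case: (boolP (x \in _)) => xA.
  rewrite mule1 -(lebesgue_measure_abs_le (dotv x u) eps0).
  apply: le_measure; rewrite ?inE.
  - exact: measurable_section.
  - exact: measurable_abs_le.
  - by move=> y [[]]; rewrite /= cons_rV0 tail_cons.
rewrite mule0 (_ : [set y | _] = set0) ?measure0//.
apply/seteqP; split => // y [[]]; rewrite /= cons_rV0 tail_cons => Ax yx yc.
move/negP: xA; apply; rewrite inE; split => //=.
rewrite /slab/= -[dotv x u](subrK y) (le_trans (ler_normD _ _))// addrC lerD//.
by rewrite distrC.
Qed.

(** When [|x . u| <= c], the condition [|y| <= c + eps] does not truncate the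
interval of radius [eps] around [x . u]. *)
Lemma lebesgue_rV_thick_graph_ge A u (eps c : R) : closed A -> 0 <= eps ->
  ((2 * eps)%:E * lebesgue_rV R n (A `&` slab u c) <=
   lebesgue_rV R n.+1
     (thick_graph A u eps `&`
      [set z : 'rV[R]_n.+1 | (`|z ord0 ord0| <= c + eps)%R]))%E.
Proof.
move=> cA eps0.
have mA : measurable (A `&` slab u c : set (borel_rV R n)).
  by apply: closed_measurable_rV; apply: closedI => //; exact: closed_slab.
have mS : measurable (thick_graph A u eps `&`
    [set z : 'rV[R]_n.+1 | (`|z ord0 ord0| <= c + eps)%R] :
    set (borel_rV R n.+1)).
  apply: closed_measurable_rV; apply: closedI; first exact: closed_thick_graph.
  by apply: closed_abs_le; exact: coord_continuous.
have e2 : 0 <= 2 * eps by rewrite mulr_ge0.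
rewrite lebesgue_rV_section// -(integral_cst_indic mA)//.
apply: ge0_le_integral => //.
- by move=> x _; rewrite -EFinM lee_fin mulr_ge0.
- by apply: emeasurable_funM => //; exact/measurable_EFinP.
- exact: measurable_fun_section.
move=> x _; rewrite indicE; case: (boolP (x \in _)) => [|_]; last first.
  by rewrite mule0.
rewrite inE => -[Ax xuc].
rewrite mule1 -(lebesgue_measure_abs_le (dotv x u) eps0).
apply: le_measure; rewrite ?inE.
- exact: measurable_abs_le.
- exact: measurable_section.
move=> y yx; split; first by split; rewrite /= ?cons_rV0 tail_cons.
rewrite /= cons_rV0 -[y](subrK (dotv x u)) addrC (le_trans (ler_normD _ _))//.
by rewrite lerD.
Qed.

End thick_graphs.


(** * Weighted geometric means *)

Definition geomean (R : realType) (l x y : R) : R := x `^ l * y `^ (1 - l).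

Section geometric_mean.
Context (R : realType) (l : R).
Hypothesis l01 : 0 < l < 1.
Implicit Types x y z w c d : R.

Let l0 : 0 <= l. Proof. by case/andP: l01 => /ltW. Qed.
Let l1 : 0 <= 1 - l. Proof. by case/andP: l01 => _ /ltW; rewrite subr_ge0. Qed.

Lemma geomean_ge0 x y : 0 <= geomean l x y.
Proof. by rewrite mulr_ge0// powR_ge0. Qed.

Lemma geomean_gt0 x y : 0 < x -> 0 < y -> 0 < geomean l x y.
Proof. by move=> x0 y0; rewrite mulr_gt0// powR_gt0. Qed.

Lemma geomeanxx x : 0 <= x -> geomean l x x = x.
Proof.
move=> x0; rewrite /geomean -powRD; last by rewrite addrC subrK oner_eq0.
by rewrite addrC subrK powRr1.
Qed.

Lemma geomeanM x y z w : 0 <= x -> 0 <= y -> 0 <= z -> 0 <= w ->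
  geomean l (x * z) (y * w) = geomean l x y * geomean l z w.
Proof. by move=> x0 y0 z0 w0; rewrite /geomean !powRM// mulrACA. Qed.

Lemma geomeanV x y : 0 < x -> 0 < y ->
  geomean l x^-1 y^-1 = (geomean l x y)^-1.
Proof.
move=> x0 y0; apply: (mulIf (lt0r_neq0 (geomean_gt0 x0 y0))).
rewrite mulVf ?lt0r_neq0 ?geomean_gt0// -geomeanM ?invr_ge0 ?ltW//.
by rewrite !mulVf ?lt0r_neq0// geomeanxx.
Qed.

Lemma le_geomean x y z w : 0 <= x -> x <= z -> 0 <= y -> y <= w ->
  geomean l x y <= geomean l z w.
Proof.
move=> x0 xz y0 yw.
have z0 := le_trans x0 xz; have w0 := le_trans y0 yw.
by rewrite ler_pM ?powR_ge0// ge0_ler_powR// nnegrE.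
Qed.

Lemma geomean_prod n (c d : 'I_n -> R) :
  (forall i, 0 < c i) -> (forall i, 0 < d i) ->
  geomean l (\prod_(i < n) c i) (\prod_(i < n) d i) =
  \prod_(i < n) geomean l (c i) (d i).
Proof.
move=> c0 d0.
have : 0 <= \prod_(i < n) c i /\ 0 <= \prod_(i < n) d i.
  by split; apply: prodr_ge0 => i _; exact: ltW.
elim: n c d c0 d0 => [|n IHn] c d c0 d0 _.
  by rewrite !big_ord0 geomeanxx.
have P (e : 'I_n.+1 -> R) : (forall i, 0 < e i) ->
    0 <= \prod_(i < n) e (lift ord0 i).
  by move=> e0; apply: prodr_ge0 => i _; exact: ltW.
by rewrite !big_ord_recl geomeanM ?P ?ltW// IHn//; split; exact: P.
Qed.

(** A one-sided continuity of the geometric mean, obtained from homogeneity: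
with [m] the minimum of [c] and [d], adding [e] to both is at most scaling both
by [1 + e / m]. *)
Lemma le_geomean_lim c d x : 0 < c -> 0 < d ->
  (forall e, 0 < e -> x <= geomean l (c + e) (d + e) + e) ->
  x <= geomean l c d.
Proof.
move=> c0 d0 xe; pose m := Num.min c d.
have m0 : 0 < m by rewrite lt_min c0.
have [mc md] : m <= c /\ m <= d by rewrite !ge_min !lexx orbT.
have k0 : 0 < geomean l c d / m + 1.
  by rewrite ltr_wpDl// divr_ge0 ?geomean_ge0// ltW.
apply/ler_addgt0Pr => e e0.
pose e' := e / (geomean l c d / m + 1).
have e'0 : 0 < e' by rewrite divr_gt0.
apply: (le_trans (xe _ e'0)).
have le_scale z : m <= z -> z + e' <= (1 + e' / m) * z.
  move=> mz; rewrite mulrDl mul1r lerD2l mulrAC -mulrA ler_peMr ?(ltW e'0)//.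
  by rewrite ler_pdivlMr// mul1r.
have s0 : 0 <= 1 + e' / m by rewrite addr_ge0// divr_ge0// ltW.
(* the choice of e' makes the total excess over the mean exactly e *)
have -> : geomean l c d + e =
    geomean l ((1 + e' / m) * c) ((1 + e' / m) * d) + e'.
  rewrite geomeanM ?s0 ?(ltW c0) ?(ltW d0)// geomeanxx// /e'; field.
  by rewrite !lt0r_neq0//= ltr_wpDl ?geomean_ge0.
by rewrite lerD2r le_geomean ?le_scale// ltW// addr_gt0.
Qed.

Lemma poweR_geomean x y (X Y : \bar R) : 0 < x -> 0 < y ->
  (0 <= X -> 0 <= Y ->
  (x%:E * X) `^ l * (y%:E * Y) `^ (1 - l) =
  (geomean l x y)%:E * (X `^ l * Y `^ (1 - l)))%E.
Proof.
move=> x0 y0 X0 Y0; rewrite !poweRM ?lee_fin ?(ltW x0) ?(ltW y0)//.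
by rewrite !poweR_EFin muleACA EFinM.
Qed.

Lemma le_poweR_geomean (X X' Y Y' : \bar R) :
  (0 <= X -> X <= X' -> 0 <= Y -> Y <= Y' ->
   X `^ l * Y `^ (1 - l) <= X' `^ l * Y' `^ (1 - l))%E.
Proof.
move=> X0 XX Y0 YY; apply: lee_pmul; rewrite ?poweR_ge0//.
- apply: gt0_ler_poweR => //; rewrite in_itv/= leey andbT//.
  exact: le_trans XX.
- apply: gt0_ler_poweR => //; rewrite in_itv/= leey andbT//.
  exact: le_trans YY.
Qed.

End geometric_mean.


(** * Operations on symmetric convex bodies *)

Section bodies.
Context (R : realType).

Lemma finite_lower_bound n (a : 'I_n -> R) :
  (forall i, 0 < a i) -> exists2 r, 0 < r & forall i, r <= a i.
Proof.
elim: n a => [a _|n IHn a a0]; first by exists 1 => // -[].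
have [r r0 ra] := IHn (fun i => a (lift ord0 i)) (fun i => a0 _).
exists (Num.min r (a ord0)); first by rewrite lt_min r0 a0.
move=> i; rewrite ge_min; case: (unliftP ord0 i) => [j|] ->.
  by rewrite ra.
by rewrite lexx orbT.
Qed.

Lemma finite_upper_bound n (a : 'I_n -> R) :
  exists2 r, 0 < r & forall i, a i <= r.
Proof.
exists (1 + \sum_i `|a i|); first by rewrite ltr_wpDr// sumr_ge0.
move=> i; rewrite (bigD1 i)//= addrA ler_wpDr ?sumr_ge0//.
by rewrite (le_trans (ler_norm _))// lerDr.
Qed.

Lemma norm_dotv_le n (x u : 'rV[R]_n) B : box (fun=> B) x ->
  `|dotv x u| <= B * \sum_i `|u ord0 i|.
Proof.
move=> xB; rewrite (le_trans (ler_norm_sum _ _ _))// mulr_sumr.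
by apply: ler_sum => i _; rewrite normrM ler_wpM2r.
Qed.

Lemma box_convex n (a : 'I_n -> R) x y t : 0 <= t <= 1 -> box a x -> box a y ->
  box a (t *: x + (1 - t) *: y).
Proof.
move=> /andP[t0 t1] xa ya i; rewrite !mxE.
have t1' : 0 <= 1 - t by rewrite subr_ge0.
rewrite (le_trans (ler_normD _ _))// !normrM (ger0_norm t0) (ger0_norm t1').
rewrite (le_trans (lerD (ler_wpM2l t0 (xa i)) (ler_wpM2l t1' (ya i))))//.
by rewrite -mulrDl addrC subrK mul1r.
Qed.

Lemma box_opp n (a : 'I_n -> R) x : box a x -> box a (- x).
Proof. by move=> xa i; rewrite mxE normrN. Qed.

Lemma symmetric_convex_body_box n (a : 'I_n -> R) : (forall i, 0 < a i) ->
  symmetric_convex_body (box a).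
Proof.
move=> a0; apply/symmetric_convex_bodyP; split.
- exact: closed_box.
- have [B B0 aB] := finite_upper_bound a.
  by exists B => // x xa i; rewrite (le_trans (xa i)).
- by move=> x y t; exact: box_convex.
- by move=> x; exact: box_opp.
- have [r r0 ra] := finite_lower_bound a0.
  by exists r => // x xr i; rewrite (le_trans (xr i)).
Qed.

Lemma symmetric_convex_body_setI n (K L : set 'rV[R]_n) :
  symmetric_convex_body K -> symmetric_convex_body L ->
  symmetric_convex_body (K `&` L).
Proof.
move=> /symmetric_convex_bodyP[cK [B B0 KB] vK sK [r r0 rK]].
move=> /symmetric_convex_bodyP[cL _ vL sL [s s0 sL']].
apply/symmetric_convex_bodyP; split.
- exact: closedI.
- by exists B => // x [/KB].
- by move=> x y t t01 [Kx Lx] [Ky Ly]; split; [exact: vK|exact: vL].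
- by move=> x [Kx Lx]; split; [exact: sK|exact: sL].
- exists (Num.min r s); first by rewrite lt_min r0.
  move=> x xrs; split; [apply: rK|apply: sL'] => i;
    by rewrite (le_trans (xrs i))// ge_min lexx ?orbT.
Qed.

Lemma diag_imageE n (c : 'I_n -> R) (K : set 'rV[R]_n) :
  (forall i, 0 < c i) ->
  diag_image c K = stretch (fun i => (c i)^-1) @^-1` K.
Proof.
move=> c0; have diagE x i : (x *m diag_mx (\row_j c j)) ord0 i = x ord0 i * c i.
  by rewrite mul_mx_diag !mxE.
apply/seteqP; split => [_ [x Kx <-]|x /= Kx].
  rewrite /= (_ : stretch _ _ = x)//; apply/rowP => i.
  by rewrite mxE diagE mulrC mulfK// lt0r_neq0.
exists (stretch (fun i => (c i)^-1) x) => //; apply/rowP => i.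
by rewrite diagE mxE mulrAC mulVf ?mul1r// lt0r_neq0.
Qed.

Lemma stretchD n (c : 'I_n -> R) x y :
  stretch c (x + y) = stretch c x + stretch c y.
Proof. by apply/rowP => i; rewrite !mxE mulrDr. Qed.

Lemma stretchZ n (c : 'I_n -> R) t x : stretch c (t *: x) = t *: stretch c x.
Proof. by apply/rowP => i; rewrite !mxE mulrCA. Qed.

Lemma stretchN n (c : 'I_n -> R) x : stretch c (- x) = - stretch c x.
Proof. by rewrite -scaleN1r stretchZ scaleN1r. Qed.

Lemma symmetric_convex_body_diag n (c : 'I_n -> R) (K : set 'rV[R]_n) :
  (forall i, 0 < c i) -> symmetric_convex_body K ->
  symmetric_convex_body (diag_image c K).
Proof.
move=> c0 /symmetric_convex_bodyP[cK [B B0 KB] vK sK [r r0 rK]].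
rewrite diag_imageE//; apply/symmetric_convex_bodyP; split.
- by apply: closed_preimage => //; exact: continuous_stretch.
- have [C C0 cC] := finite_upper_bound c.
  exists (C * B); first by rewrite mulr_gt0.
  move=> x /KB xB i; have := xB i; rewrite mxE normrM gtr0_norm ?invr_gt0//.
  rewrite ler_pdivrMl// => /le_trans; apply.
  by rewrite ler_wpM2r// ltW.
- by move=> x y t t01 Kx Ky; rewrite /= stretchD !stretchZ; exact: vK.
- by move=> x Kx; rewrite /= stretchN; exact: sK.
- have [s s0 sc] := finite_lower_bound c0.
  exists (s * r); first by rewrite mulr_gt0.
  move=> x xsr; apply: rK => i; rewrite mxE normrM gtr0_norm ?invr_gt0//.
  rewrite ler_pdivrMl// (le_trans (xsr i))//.
  by rewrite ler_wpM2r// ltW.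
Qed.

Lemma symmetric_convex_body_thick_graph n (K : set 'rV[R]_n) u eps :
  symmetric_convex_body K -> 0 < eps ->
  symmetric_convex_body (thick_graph K u eps).
Proof.
move=> /symmetric_convex_bodyP[cK [B B0 KB] vK sK [r r0 rK]] eps0.
have tailD (x y : 'rV[R]_n.+1) : tail (x + y) = tail x + tail y.
  by apply/rowP => i; rewrite !mxE.
have tailZ t (x : 'rV[R]_n.+1) : tail (t *: x) = t *: tail x.
  by apply/rowP => i; rewrite !mxE.
have tailN (x : 'rV[R]_n.+1) : tail (- x) = - tail x.
  by apply/rowP => i; rewrite !mxE.
pose S := \sum_i `|u ord0 i|.
have S0 : 0 <= S by exact: sumr_ge0.
apply/symmetric_convex_bodyP; split.
- exact: closed_thick_graph.
- exists (B + B * S + eps).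
    by rewrite addr_gt0// ltr_wpDr// mulr_ge0// ltW.
  move=> z [/KB zB zu] i; case: (unliftP ord0 i) => [j|] ->.
    have := zB j; rewrite mxE => /le_trans; apply.
    by rewrite -addrA lerDl addr_ge0 ?mulr_ge0 ?(ltW B0) ?(ltW eps0).
  rewrite -[z ord0 ord0](subrK (dotv (tail z) u)) (le_trans (ler_normD _ _))//.
  rewrite addrC lerD//.
  by rewrite (le_trans (norm_dotv_le _ zB))// lerDr ltW.
- move=> x y t t01 [Kx xu] [Ky yu]; split; rewrite tailD !tailZ.
    exact: vK.
  have row_box c : `|c| <= eps -> box (fun=> eps) (\row_(i < 1) c).
    by move=> ce i; rewrite mxE.
  (* the affine slab is convex because a one-dimensional box is *)
  have := box_convex t01 (row_box _ xu) (row_box _ yu) ord0.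
  rewrite !mxE dotvDl !dotvZl; set a := (X in `|X| <= _ -> _) => ae.
  by rewrite [X in `|X| <= _](_ : _ = a)// /a; ring.
- move=> x [Kx xu]; split; rewrite tailN; first exact: sK.
  by rewrite dotvNl mxE -opprD normrN.
- exists (Num.min r (eps / (1 + S))).
    by rewrite lt_min r0 divr_gt0// ltr_wpDr.
  move=> z zr.
  have zr' i : `|z ord0 i| <= eps / (1 + S).
    by rewrite (le_trans (zr i))// ge_min lexx orbT.
  split; first by apply: rK => i; rewrite mxE (le_trans (zr _))// ge_min lexx.
  rewrite (le_trans (ler_normB _ _))//.
  have tz : box (fun=> eps / (1 + S)) (tail z) by move=> i; rewrite mxE.
  rewrite (le_trans (lerD (zr' ord0) (norm_dotv_le u tz)))//.
  rewrite -/S -[X in X + _]mulr1 -mulrDr divfK//.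
  by rewrite lt0r_neq0// ltr_wpDr.
Qed.

End bodies.

(** * Support functions and separation *)

Section support_functions.
Context (R : realType) (n : nat).
Implicit Types (K : set 'rV[R]_n) (u : 'rV[R]_n).

Lemma support_fun_ge K B u y : K `<=` box (fun=> B) -> K y ->
  dotv y u <= support_fun K u.
Proof.
move=> KB Ky; apply: ub_le_sup; last by exists y => //; exact: dotvC.
exists (B * \sum_i `|u ord0 i|) => _ [z /KB zB <-].
by rewrite dotvC (le_trans (ler_norm _))// norm_dotv_le.
Qed.

Lemma support_fun_le K u c : K !=set0 -> (forall y, K y -> dotv y u <= c) ->
  support_fun K u <= c.
Proof.
move=> [y Ky] Kc; apply: ge_sup; first by exists (dotv u y), y.
by move=> _ [z Kz <-]; rewrite dotvC; exact: Kc.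
Qed.

(** A body contains a small multiple of [u], on which [u] is positive. *)
Lemma support_fun_gt0 K u : symmetric_convex_body K -> u != 0 ->
  0 < support_fun K u.
Proof.
move=> /symmetric_convex_bodyP[_ [B _ KB] _ _ [r r0 rK]] u0.
have [M M0 uM] := finite_upper_bound (fun i => `|u ord0 i|).
have rM0 : 0 < r / M by rewrite divr_gt0.
apply: (@lt_le_trans _ _ (dotv ((r / M) *: u) u)).
  by rewrite dotvZl mulr_gt0// dotvv_gt0.
apply: (support_fun_ge _ KB); apply: rK => i.
by rewrite mxE normrM (gtr0_norm rM0) mulrAC ler_pdivrMr// ler_wpM2l// ltW.
Qed.

Lemma support_fun_Lipschitz K B u v : K `<=` box (fun=> B) -> K !=set0 ->
  support_fun K u <= support_fun K v + B * \sum_i `|(u - v) ord0 i|.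
Proof.
move=> KB K0; apply: support_fun_le => // y Ky.
rewrite -[u in dotv y u](subrK v) dotvDr addrC lerD//.
  exact: (support_fun_ge _ KB).
by rewrite (le_trans (ler_norm _))// norm_dotv_le//; exact: KB.
Qed.

(** With [p] a point of [K] at least Euclidean distance from [x], the direction
[x - p] separates: if some [y] of [K] had [(y - p) . (x - p) > 0], moving from
[p] towards [y] would decrease the distance to [x]. The direction is normalised
because the logarithmic combination only tests unit vectors. *)
Lemma separation K x :
  compact K -> K !=set0 ->
  (forall x y t, 0 <= t <= 1 -> K x -> K y -> K (t *: x + (1 - t) *: y)) ->
  ~ K x ->
  exists u, sphere u /\
    exists2 c, forall y, K y -> dotv y u <= c & c < dotv x u.
Proof.
move=> cK K0 vK nKx.
pose f y := dotv (x - y) (x - y).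
have cf : continuous f.
  move=> y; rewrite /f /dotv; move: y; apply: continuous_big => [|i _].
    by move=> z; exact: add_continuous.
  have cx : continuous (fun y : 'rV[R]_n => (x - y) ord0 i).
    move=> y; rewrite (_ : (fun _ => _) =
        (fun y : 'rV[R]_n => x ord0 i - y ord0 i)).
      apply: (@continuousB _ _ _ (fun=> x ord0 i)); first exact: cst_continuous.
      exact: coord_continuous.
    by apply/funext => z; rewrite !mxE.
  by move=> y; apply: continuousM; exact: cx.
have [p pK pmin] := EVT_min_rV K0 cK (continuous_subspaceT cf).
have {}pK : K p by move: pK; rewrite inE.
have {}pmin y : K y -> f p <= f y by move=> Ky; apply: pmin; rewrite inE.
set u := x - p.
have u0 : u != 0.
  by apply: contra_notN nKx; rewrite subr_eq0 => /eqP ->.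
have uu0 := dotvv_gt0 u0.
have Ku y : K y -> dotv (y - p) u <= 0.
  move=> Ky; rewrite leNgt; apply/negP; set w := y - p => d0.
  set d := dotv w u in d0; pose q := dotv w w.
  have q0 : 0 <= q.
    by apply: sumr_ge0 => i _; rewrite -expr2 sqr_ge0.
  (* moving by t towards y changes the squared distance by - 2 t d + t^2 q,
     negative for this t since t q <= d *)
  pose t := d / (d + q).
  have dq0 : 0 < d + q by rewrite ltr_pwDl.
  have t0 : 0 < t by rewrite divr_gt0.
  have t1 : t <= 1 by rewrite ler_pdivrMr// mul1r lerDl.
  have := pmin _ (vK y p t _ Ky pK).
  have -> : f (t *: y + (1 - t) *: p) = f p - 2 * t * d + t * t * q.
    rewrite /f (_ : x - _ = u + (- t) *: w); last first.
      by apply/rowP => i; rewrite !mxE; ring.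
    by rewrite dotv_sqrD -/d -/q -/u; ring.
  rewrite (ltW t0) t1 => /(_ isT).
  suff : 2 * t * d > t * t * q by lra.
  have -> : t * t * q = t * (t * q) by ring.
  have -> : 2 * t * d = t * (2 * d) by ring.
  rewrite ltr_pM2l// (@le_lt_trans _ _ d)//; last by lra.
  by rewrite mulrAC ler_pdivrMr// ler_wpM2l ?(ltW d0)// lerDr ltW.
pose s := Num.sqrt (dotv u u).
have s0 : 0 < s by rewrite sqrtr_gt0.
exists (s^-1 *: u); split.
  rewrite /sphere /= dotvZl dotvZr mulrA -invfM -expr2 sqr_sqrtr ?ltW//.
  by rewrite mulVf ?sqrtr1// lt0r_neq0.
exists (s^-1 * dotv p u) => [y Ky|].
  rewrite dotvZr ler_wpM2l ?invr_ge0 ?(ltW s0)//.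
  by have := Ku _ Ky; rewrite dotvDl dotvNl subr_le0.
rewrite dotvZr ltr_pM2l ?invr_gt0//.
by rewrite -subr_gt0 -dotvNl -dotvDl.
Qed.

End support_functions.


(** * The (B)-property of the cube as an inequality for boxes *)

Definition box_log_concave (R : realType) n : Prop :=
  forall (K : set 'rV[R]_n) (a b : 'I_n -> R) (l : R),
    symmetric_convex_body K -> (forall i, 0 < a i) -> (forall i, 0 < b i) ->
    0 < l < 1 ->
    (lebesgue_rV R n (K `&` box a) `^ l *
     lebesgue_rV R n (K `&` box b) `^ (1 - l)%R <=
     lebesgue_rV R n (K `&` box (fun i => geomean l (a i) (b i))))%E.

Section cube_measure.
Context (R : realType) (n : nat).

Lemma lebesgue_rV_cube : lebesgue_rV R n (cube R n) = 1%E.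
Proof.
have := @lebesgue_rV_box R n (fun=> `[- 2^-1, 2^-1]%classic)
  (fun=> measurable_itv _).
rewrite big1 => [<- //|i _]; rewrite lebesgue_measure_itv/= lte_fin.
rewrite gtrN ?invr_gt0// -EFinB; congr EFin.
by rewrite opprK; field.
Qed.

Lemma symmetric_convex_body_closed (K : set 'rV[R]_n) :
  symmetric_convex_body K -> closed K.
Proof. by case/symmetric_convex_bodyP. Qed.

(** The cube pulled back by the diagonal matrix is the box of half-widths
[1 / (2 c i)]. *)
Lemma uniform_cube_diag_image (K : set 'rV[R]_n) (c : 'I_n -> R) :
  closed K -> (forall i, 0 < c i) ->
  (uniform_measure (measurable_cube R n) (diag_image c K) =
   (\prod_(i < n) c i)%:E *
     lebesgue_rV R n (K `&` box (fun i => (2 * c i)^-1)%R))%E.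
Proof.
move=> cK c0; rewrite /uniform_measure lebesgue_rV_cube inve1 mule1.
have cV0 i : 0 < (c i)^-1 by rewrite invr_gt0.
have mKb : measurable (K `&` box (fun i => (2 * c i)^-1) : set (borel_rV R n)).
  by apply: closed_measurable_rV; apply: closedI => //; exact: closed_box.
rewrite -(lebesgue_rV_stretch cV0 mKb) muleA -EFinM -big_split/=.
rewrite big1 => [|i _]; last by rewrite mulfV// lt0r_neq0.
rewrite mul1e diag_imageE//; congr (lebesgue_rV R n _).
rewrite setIC preimage_setI; congr (_ `&` _); apply/funext => x.
apply/propext; split => xc i; have := xc i; rewrite !mxE normrM gtr0_norm//.
  by rewrite in_itv/= -ler_norml invfM mulrC ler_pM2r.
by rewrite in_itv/= -ler_norml invfM mulrC ler_pM2r.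
Qed.

(** The determinants are multiplicative along geometric means, hence cancel from
the two sides. *)
Lemma uniform_cube_diag_geomean (K : set 'rV[R]_n) (a b c d : 'I_n -> R) l :
  closed K -> (forall i, 0 < c i) -> (forall i, 0 < d i) -> 0 < l < 1 ->
  (forall i, (2 * c i)^-1 = a i) -> (forall i, (2 * d i)^-1 = b i) ->
  let mu := uniform_measure (measurable_cube R n) in
  let vol a := lebesgue_rV R n (K `&` box a) in
  (mu (diag_image c K) `^ l * mu (diag_image d K) `^ (1 - l)%R <=
   mu (diag_image (fun i => geomean l (c i) (d i)) K))%E =
  (vol a `^ l * vol b `^ (1 - l)%R <= vol (fun i => geomean l (a i) (b i)))%E.
Proof.
move=> cK c0 d0 l01 /funext <- /funext <- mu vol.
have g0 i : 0 < geomean l (c i) (d i) by exact: geomean_gt0.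
rewrite /mu !uniform_cube_diag_image// poweR_geomean ?prodr_gt0//.
rewrite geomean_prod// lee_pmul2l//; last by rewrite lte_fin prodr_gt0.
congr (_ <= lebesgue_rV R n (K `&` box _))%E.
apply/funext => i; rewrite geomeanV ?mulr_gt0//.
rewrite geomeanM ?(ltW (c0 i)) ?(ltW (d0 i))//.
by rewrite geomeanxx.
Qed.

Lemma diag_image_comp (K : set 'rV[R]_n) (c d : 'I_n -> R) :
  diag_image d (diag_image c K) = diag_image (fun i => d i * c i) K.
Proof.
have diagE x : x *m diag_mx (\row_i c i) *m diag_mx (\row_i d i) =
    x *m diag_mx (\row_i (d i * c i)) :> 'rV[R]_n.
  by apply/rowP => i; rewrite !mul_mx_diag !mxE -mulrA [c i * _]mulrC.
apply/seteqP; split => [_ [_ [x Kx <-] <-]|_ [x Kx <-]].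
  by exists x.
by exists (x *m diag_mx (\row_i c i)) => //; exists x.
Qed.

(** A pair of boxes is a pair of values of [s] in the family
[s |-> diag (t_i^s) K]: given half-widths [a] and [b], the body is rescaled so
that [s = 0] yields the box [a], and [t i = a i / b i] makes [s = 1] yield the
box [b]. *)
Lemma B_property_cubeP :
  B_property (uniform_measure (measurable_cube R n)) <-> box_log_concave R n.
Proof.
split=> [BP K a b l bK a0 b0 l01|bP K t bK t0 a b l l01].
  pose c i := (2 * a i)^-1; pose d i := (2 * b i)^-1.
  have c0 i : 0 < c i by rewrite invr_gt0 mulr_gt0.
  have d0 i : 0 < d i by rewrite invr_gt0 mulr_gt0.
  have dc0 i : 0 < d i / c i by rewrite divr_gt0.
  have cK := symmetric_convex_body_closed bK.
  have cE i : (2 * c i)^-1 = a i by rewrite invfM invrK mulKf.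
  have dE i : (2 * d i)^-1 = b i by rewrite invfM invrK mulKf.
  rewrite -(uniform_cube_diag_geomean cK c0 d0 l01 cE dE).
  have diagE s e : (forall i, (d i / c i) `^ s * c i = e i) ->
      diag_image (fun i => (d i / c i) `^ s) (diag_image c K) = diag_image e K.
    by rewrite diag_image_comp => /funext ->.
  have := BP _ _ (symmetric_convex_body_diag c0 bK) dc0 0 1 l l01.
  rewrite (diagE 0 c) => [|i]; last by rewrite powRr0 mul1r.
  rewrite (diagE 1 d) => [|i]; last by rewrite powRr1 ?ltW// divfK ?lt0r_neq0.
  rewrite (diagE _ (fun i => geomean l (c i) (d i)))// => i.
  rewrite mulr0 add0r mulr1 -[X in _ * X = _](geomeanxx l (ltW (c0 i))).
  rewrite /geomean mulrCA -powRM ?(ltW (dc0 i)) ?(ltW (c0 i))//.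
  by rewrite divfK ?lt0r_neq0.
have c0 s i : 0 < t i `^ s by exact: powR_gt0.
have cK := symmetric_convex_body_closed bK.
rewrite (_ : (fun i => t i `^ (l * a + (1 - l) * b)) =
    fun i => geomean l (t i `^ a) (t i `^ b)).
  rewrite (uniform_cube_diag_geomean cK _ _ _ (fun=> erefl) (fun=> erefl))//.
  by apply: bP => // i; rewrite invr_gt0 mulr_gt0.
apply/funext => i; rewrite /geomean -!powRrM -powRD; last first.
  by rewrite (gt_eqF (t0 i)) implybT.
by congr (_ `^ _); ring.
Qed.

End cube_measure.


(** * From log-Brunn-Minkowski to boxes *)

Section log_combination.
Context (R : realType) (n : nat).
Implicit Types K L : set 'rV[R]_n.

Lemma closed_log_comb l K L : closed (log_comb l K L).
Proof.
apply: closed_forall => u; apply: closed_forall => _.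
apply: (@closed_preimage _ _ (fun x => dotv x u) [set y | y <= _]).
  exact: continuous_dotv.
exact: closed_le.
Qed.

(** Every half-space containing [K] contains the left-hand side, because both
support functions are at most the one of [K] and so is their geometric mean;
the coordinate directions give the box. *)
Lemma log_comb_setI_box l K (a b : 'I_n -> R) : 0 < l < 1 ->
  symmetric_convex_body K -> (forall i, 0 < a i) -> (forall i, 0 < b i) ->
  log_comb l (K `&` box a) (K `&` box b) `<=`
  K `&` box (fun i => geomean l (a i) (b i)).
Proof.
move=> l01 bK a0 b0 x xC.
have [cK _ vK sK [r r0 rK]] := (symmetric_convex_bodyP K).1 bK.
have K0 : K 0 by apply: rK => i; rewrite mxE normr0 ltW.
have le_comb u c d : sphere u -> 0 <= c -> 0 <= d ->
    (forall y, K y -> box a y -> dotv y u <= c) ->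
    (forall y, K y -> box b y -> dotv y u <= d) -> dotv x u <= geomean l c d.
  move=> u1 c0 d0 Kc Kd; apply: (le_trans (xC u u1)).
  have Ka0 e : (forall i, 0 < e i) -> (K `&` box e) 0.
    by move=> e0; split => // i; rewrite mxE normr0 ltW.
  have sup_ge0 e : (forall i, 0 < e i) -> 0 <= support_fun (K `&` box e) u.
    move=> e0; have [B _ eB] := finite_upper_bound e.
    rewrite (_ : 0 = dotv 0 u); last by rewrite dotvC dotv0.
    apply: (@support_fun_ge _ _ _ B); last exact: Ka0.
    by move=> y [_ ye] i; rewrite (le_trans (ye i)).
  apply: le_geomean => //; try exact: sup_ge0.
  - by apply: support_fun_le; [exists 0; exact: Ka0|move=> y [? ?]; exact: Kc].
  - by apply: support_fun_le; [exists 0; exact: Ka0|move=> y [? ?]; exact: Kd].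
have sphereN (u : 'rV[R]_n) : sphere u -> sphere (- u).
  by rewrite /sphere /= dotvNl dotvC dotvNl opprK.
split=> [|i].
  apply: contrapT => nKx.
  have [|u [u1 [c Kc]]] := separation _ (ex_intro _ _ K0) vK nKx.
    by case: bK => -[].
  have c0 : 0 <= c by have := Kc _ K0; rewrite dotvC dotv0.
  apply/negP; rewrite -leNgt -[c](geomeanxx l)//.
  by apply: le_comb => // y Ky _; exact: Kc.
have e1 : sphere (delta_mx ord0 i : 'rV[R]_n).
  by rewrite /sphere /= dotv_delta mxE !eqxx sqrtr1.
have ai := ltW (a0 i); have bi := ltW (b0 i).
rewrite ler_norml; apply/andP; split.
  rewrite lerNl -(dotv_delta x) -dotvNr.
  apply: (le_comb _ _ _ (sphereN _ e1) ai bi) => y _ yab;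
    by rewrite dotvNr dotv_delta (le_trans (ler_norm _))// normrN.
rewrite -(dotv_delta x); apply: le_comb => // y _ yab; rewrite dotv_delta;
  exact: le_trans (ler_norm _) (yab i).
Qed.

Lemma box_log_concave_of_log_BM :
  (forall l : R, 0 <= l <= 1 -> forall K L,
     symmetric_convex_body K -> symmetric_convex_body L ->
     log_Brunn_Minkowski l K L) -> box_log_concave R n.
Proof.
move=> BM K a b l bK a0 b0 l01.
have l01' : 0 <= l <= 1 by case/andP: l01 => /ltW -> /ltW ->.
have bKb e : (forall i, 0 < e i) -> symmetric_convex_body (K `&` box e).
  move=> e0; apply: symmetric_convex_body_setI => //.
  exact: symmetric_convex_body_box.
apply: (le_trans (BM l l01' _ _ (bKb a a0) (bKb b b0))).
apply: le_measure; last exact: log_comb_setI_box.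
  by rewrite inE; apply: closed_measurable_rV; exact: closed_log_comb.
rewrite inE; apply: closed_measurable_rV; apply: symmetric_convex_body_closed.
by apply: bKb => i; exact: geomean_gt0.
Qed.

End log_combination.

(** * Continuity of volume from above *)

Section continuity_from_above.
Context (R : realType) (n : nat).

Lemma lebesgue_rV_bounded (A : set (borel_rV R n)) B : measurable A ->
  A `<=` box (fun=> B) -> (lebesgue_rV R n A < +oo)%E.
Proof.
move=> mA AB.
have bE : [set v : 'rV[R]_n | forall i, `[- B, B]%classic (v ord0 i)] =
    (box (fun=> B) : set 'rV[R]_n).
  by apply/seteqP; split => x xB i; have := xB i; rewrite /= in_itv/= ler_norml.
apply: (@le_lt_trans _ _ (lebesgue_rV R n (box (fun=> B)))).
  apply: le_measure; rewrite ?inE//.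
  by apply: closed_measurable_rV; exact: closed_box.
have -> : lebesgue_rV R n (box (fun=> B)) =
    (\prod_(i < n) @lebesgue_measure R `[(- B)%R, B])%E.
  rewrite -bE.
  exact: (lebesgue_rV_box (A := fun=> `[- B, B]%classic)
    (fun=> measurable_itv _)).
rewrite -ge0_fin_numE ?prode_ge0//.
by apply: prode_fin_num => i _; rewrite lebesgue_measure_itv/=; case: ifP.
Qed.

Lemma lebesgue_rV_bigcap_ge (F : nat -> set 'rV[R]_n) B (v : \bar R) :
  (forall k, closed (F k)) -> F 0%N `<=` box (fun=> B) ->
  (forall k, F k.+1 `<=` F k) -> (forall k, v <= lebesgue_rV R n (F k))%E ->
  (v <= lebesgue_rV R n (\bigcap_k F k))%E.
Proof.
move=> cF FB decF vF.
have mF k : measurable (F k : set (borel_rV R n)).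
  exact: closed_measurable_rV.
have : lebesgue_rV R n \o F @ \oo --> lebesgue_rV R n (\bigcap_k F k).
  apply: nonincreasing_cvg_mu => //.
  - exact: lebesgue_rV_bounded FB.
  - exact: bigcap_measurable.
  - by apply/nonincreasing_seqP => k; apply/subsetPset; exact: decF.
by apply: cvge_ge; apply: nearW => k /=; exact: vF.
Qed.

End continuity_from_above.


(** * From boxes in all dimensions to boxes cut by slabs *)

Definition cuts (R : realType) n (s : seq 'rV[R]_n) (c : 'rV[R]_n -> R) :
    set 'rV[R]_n :=
  [set x | forall u, u \in s -> `|dotv x u| <= c u].

Section slabs.
Context (R : realType).

Lemma closed_cuts n (s : seq 'rV[R]_n) c : closed (cuts s c).
Proof.
apply: closed_forall => u; apply: closed_forall => _.
exact: closed_slab.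
Qed.

(** The radii are functions of the direction, so that they can be taken to be
support functions and can be transported to the next dimension by composition
with the projection that forgets the first coordinate. *)
Definition cut_log_concave n (s : seq 'rV[R]_n) : Prop :=
  forall (K : set 'rV[R]_n) (a b : 'I_n -> R) (c d : 'rV[R]_n -> R) (l : R),
    symmetric_convex_body K -> (forall i, 0 < a i) -> (forall i, 0 < b i) ->
    (forall u, u \in s -> 0 < c u) -> (forall u, u \in s -> 0 < d u) ->
    0 < l < 1 ->
    (lebesgue_rV R n (K `&` box a `&` cuts s c) `^ l *
     lebesgue_rV R n (K `&` box b `&` cuts s d) `^ (1 - l)%R <=
     lebesgue_rV R n (K `&` box (fun i => geomean l (a i) (b i)) `&`
                      cuts s (fun u => geomean l (c u) (d u))))%E.

Definition cons_fun n (x : R) (a : 'I_n -> R) (i : 'I_n.+1) : R :=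
  if unlift ord0 i is Some j then a j else x.

Definition lift0_rV n (u : 'rV[R]_n) : 'rV[R]_n.+1 :=
  \row_i cons_fun 0 (fun j => u ord0 j) i.

Lemma tail_lift0 n (u : 'rV[R]_n) : tail (lift0_rV u) = u.
Proof. by apply/rowP => i; rewrite !mxE /cons_fun liftK. Qed.

Lemma dotv_lift0 n z (u : 'rV[R]_n) : dotv z (lift0_rV u) = dotv (tail z) u.
Proof.
rewrite /dotv big_ord_recl mxE /cons_fun unlift_none mulr0 add0r.
by apply: eq_bigr => i _; rewrite !mxE /cons_fun liftK.
Qed.

(** Box constraints and slabs through the last coordinates pass through the
thickening, and the extra half-width [x] becomes a bound on the new first
coordinate. *)
Lemma thick_graph_cuts n (K : set 'rV[R]_n) u eps a c s x :
  thick_graph K u eps `&` box (cons_fun x a) `&`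
    cuts [seq lift0_rV v | v <- s] (c \o @tail R n) =
  thick_graph (K `&` box a `&` cuts s c) u eps `&`
    [set z | `|z ord0 ord0| <= x].
Proof.
apply/seteqP; split => z /=.
  move=> [[[Kz zu] za] zs]; split; last first.
    by have := za ord0; rewrite /cons_fun unlift_none.
  split=> //; split; [split=> // i|move=> v vs].
    by have := za (lift ord0 i); rewrite /cons_fun liftK mxE.
  have := zs (lift0_rV v); rewrite dotv_lift0 /= tail_lift0; apply.
  exact: map_f.
move=> [[[[Kz za] zs] zu] zx]; split; first split => // i.
  rewrite /cons_fun; case: unliftP => [j|] -> //.
  by have := za j; rewrite mxE.
by move=> _ /mapP[v vs ->]; rewrite dotv_lift0 /= tail_lift0; exact: zs.
Qed.

Lemma cuts_cons n (u : 'rV[R]_n) s c :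
  cuts (u :: s) c = cuts s c `&` slab u (c u).
Proof.
apply/seteqP; split => x /=.
  move=> xs; split; last by apply: xs; rewrite mem_head.
  by move=> v vs; apply: xs; rewrite inE vs orbT.
by move=> [xs xu] v; rewrite inE => /predU1P[->//|]; exact: xs.
Qed.

(** One slab is traded for one dimension: the width of the slab in the direction
[u] becomes the bound of a new box coordinate on the graph of [x |-> x . u]
thickened by [eps]. The half-widths are enlarged to [c u + eps] and
[d u + eps], so that the left-hand side has no error term and a single
decreasing limit remains on the right. The induction is on the number of slabs,
the dimension being arbitrary. *)
Lemma cut_log_concave_all : (forall n, (0 < n)%N -> box_log_concave R n) ->
  forall n (s : seq 'rV[R]_n), (0 < n)%N -> cut_log_concave s.
Proof.
move=> boxP n s; move: {2}(size s) (erefl (size s)) => m.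
elim: m n s => [|m IHm] n [|u s]// => [_ n0|[sm] n0].
  move=> K a b c d l bK a0 b0 _ _ l01.
  have cut0 e : cuts [::] e = [set: 'rV[R]_n].
    by apply/seteqP; split.
  by rewrite !cut0 !setIT; exact: boxP.
move=> K a b c d l bK a0 b0 c0 d0 l01.
have cu0 : 0 < c u by apply: c0; rewrite mem_head.
have du0 : 0 < d u by apply: d0; rewrite mem_head.
pose g i := geomean l (a i) (b i); pose r v := geomean l (c v) (d v).
pose A e (f : 'rV[R]_n -> R) := K `&` box e `&` cuts s f.
have cA e f : closed (A e f).
  apply: closedI; last exact: closed_cuts.
  apply: closedI; last exact: closed_box.
  exact: symmetric_convex_body_closed.
rewrite !cuts_cons !setIA -![_ `&` cuts s _]/(A _ _) -/g -/r.
pose rad eps := geomean l (c u + eps) (d u + eps) + eps.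
have step eps : 0 < eps ->
    (lebesgue_rV R n (A a c `&` slab u (c u)) `^ l *
     lebesgue_rV R n (A b d `&` slab u (d u)) `^ (1 - l)%R <=
     lebesgue_rV R n (A g r `&` slab u (rad eps)))%E.
  move=> eps0; have e2 : 0 < 2 * eps by rewrite mulr_gt0.
  have sz : size [seq lift0_rV v | v <- s] = m by rewrite size_map.
  have ce0 : 0 < c u + eps by rewrite addr_gt0.
  have de0 : 0 < d u + eps by rewrite addr_gt0.
  have cons0 x e : 0 < x -> (forall i : 'I_n, 0 < e i) ->
      forall i, 0 < cons_fun x e i.
    by move=> x0 e0 i; rewrite /cons_fun; case: unlift.
  have pos0 (f : 'rV[R]_n -> R) : (forall v, v \in u :: s -> 0 < f v) ->
      forall z, z \in [seq lift0_rV v | v <- s] -> 0 < (f \o @tail R n) z.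
    move=> f0 _ /mapP[v vs ->]; rewrite /= tail_lift0; apply: f0.
    by rewrite inE vs orbT.
  have := IHm _ _ sz isT _ _ _ _ _ l
    (symmetric_convex_body_thick_graph u bK eps0)
    (cons0 _ _ ce0 a0) (cons0 _ _ de0 b0) (pos0 c c0) (pos0 d d0) l01.
  rewrite (_ : (fun i => geomean l (cons_fun _ a i) (cons_fun _ b i)) =
      cons_fun (geomean l (c u + eps) (d u + eps)) g); last first.
    by apply/funext => i; rewrite /cons_fun; case: unlift.
  rewrite (_ : (fun z => geomean l ((c \o _) z) ((d \o _) z)) =
      r \o @tail R n)//.
  rewrite !thick_graph_cuts -!/(A _ _) => IH.
  rewrite -(@lee_pmul2l _ (2 * eps)%:E)// ?lte_fin//.
  rewrite -[X in (X%:E * _)%E](geomeanxx l (ltW e2)) -poweR_geomean//.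
  have V0 (S : set 'rV[R]_n) : (0 <= (2 * eps)%:E * lebesgue_rV R n S)%E.
    by rewrite mule_ge0// lee_fin ltW.
  have ge_thick e f := lebesgue_rV_thick_graph_ge u (f u) (cA e f) (ltW eps0).
  apply: (le_trans (le_poweR_geomean l01 (V0 _) (ge_thick a c) (V0 _)
    (ge_thick b d))).
  apply: (le_trans IH).
  exact: lebesgue_rV_thick_graph_le (cA _ _) (ltW eps0).
pose eps k : R := k.+1%:R^-1.
have eps0 k : 0 < eps k by rewrite invr_gt0.
have -> : A g r `&` slab u (r u) = \bigcap_k (A g r `&` slab u (rad (eps k))).
  apply/seteqP; split => x.
    move=> [Ax xu] k _; split => //; apply: (le_trans xu).
    rewrite -[leLHS]addr0 lerD ?(ltW (eps0 k))//.
    by rewrite le_geomean// ?ltW// ltrDl.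
  move=> Ax; split; first by have [] := Ax 0%N I.
  apply: le_geomean_lim => // e e0.
  have [k ke] : exists k, eps k < e.
    have /= [k _ /(_ k (leqnn k))] := near_infty_natSinv_lt (PosNum e0).
    by exists k.
  have [_ /le_trans] := Ax k I; apply.
  by rewrite lerD ?(ltW ke)// le_geomean ?lerD2l ?(ltW ke)// ltW// addr_gt0.
have [B B0 gB] := finite_upper_bound g.
apply: (@lebesgue_rV_bigcap_ge _ _ _ B) => [k|x [[[_ xg] _] _] i|k x [Ax xu]|k].
- by apply: closedI => //; exact: closed_slab.
- exact: le_trans (xg i) _.
- split=> //; apply: (le_trans xu).
  have kk : eps k.+1 <= eps k by rewrite lef_pV2 ?posrE// ler_nat.
  by rewrite lerD// le_geomean ?lerD2l// ltW// addr_gt0.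
- exact: step.
Qed.

End slabs.


(** * Approximation by finitely many rational directions *)

Section density.
Context (R : realType) (n : nat).

Definition ratr_rV (q : 'rV[rat]_n) : 'rV[R]_n := map_mx ratr q.

Lemma ratr_rV_dense (u : 'rV[R]_n) e : 0 < e ->
  exists q, \sum_i `|(u - ratr_rV q) ord0 i| <= e.
Proof.
move=> e0; pose h := e / n.+1%:R; have h0 : 0 < h by rewrite divr_gt0.
have /choice[q qP] (i : 'I_n) :
    exists q, ratr q \in `](u ord0 i), (u ord0 i + h)[.
  by apply: rat_in_itvoo; rewrite ltrDl.
exists (\row_i q i); apply: (@le_trans _ _ (\sum_(i < n) h)).
  apply: ler_sum => i _; have := qP i; rewrite !mxE in_itv/= => /andP[uq qu].
  by rewrite ltr0_norm ?subr_lt0// opprB lerBlDl ltW.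
rewrite sumr_const card_ord -mulr_natr /h mulrAC ler_pdivrMr//.
by rewrite ler_wpM2l ?(ltW e0)// ler_nat.
Qed.

(** The zero direction is excluded since support functions vanish there, while
the inequality for slabs asks for positive widths. *)
Definition rational_dirs (N : nat) : seq 'rV[R]_n :=
  [seq u <- pmap (fun k => omap ratr_rV (unpickle k)) (iota 0 N) | u != 0].

Lemma rational_dirs_neq0 N u : u \in rational_dirs N -> u != 0.
Proof. by rewrite mem_filter => /andP[]. Qed.

Lemma rational_dirs_sub N u : u \in rational_dirs N -> u \in rational_dirs N.+1.
Proof.
rewrite !mem_filter => /andP[-> ]; rewrite !mem_pmap => /mapP[k kN kE].
by apply/mapP; exists k => //; move: kN; rewrite !mem_iota/= !add0n => /ltnW.
Qed.

Lemma mem_rational_dirs q : ratr_rV q != 0 ->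
  exists N, ratr_rV q \in rational_dirs N.
Proof.
move=> q0; exists (pickle q).+1; rewrite mem_filter q0 mem_pmap; apply/mapP.
by exists (pickle q); rewrite ?mem_iota ?pickleK//= add0n ltnSn.
Qed.

(** Support functions of bounded sets are Lipschitz, so a constraint in an
arbitrary direction is the limit of the constraints in nearby rational
ones. *)
Lemma log_comb_of_rational_dirs l (K L : set 'rV[R]_n) B x : 0 < l < 1 ->
  symmetric_convex_body K -> symmetric_convex_body L ->
  0 < B -> K `<=` box (fun=> B) -> L `<=` box (fun=> B) -> box (fun=> B) x ->
  (forall N, cuts (rational_dirs N)
     (fun u => geomean l (support_fun K u) (support_fun L u)) x) ->
  log_comb l K L x.
Proof.
move=> l01 bK bL B0 KB LB xB xcuts u u1.
have u0 : u != 0.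
  apply/eqP => u0; move: u1; rewrite u0 /sphere /= dotv0 sqrtr0 => /eqP.
  by rewrite eq_sym oner_eq0.
have ne (M : set 'rV[R]_n) : symmetric_convex_body M -> M !=set0.
  by case=> -[_ _ [p /interior_subset Mp]] _; exists p.
have norm1_gt0 : 0 < \sum_i `|u ord0 i|.
  rewrite lt_neqAle sumr_ge0// andbT eq_sym; apply: contra u0 => /eqP su0.
  apply/eqP/rowP => i; rewrite mxE; apply/eqP; rewrite -normr_eq0.
  by rewrite (psumr_eq0P _ su0).
apply: le_geomean_lim => [//|||e e0]; try exact: support_fun_gt0.
(* the second bound prevents the approximating direction from vanishing *)
pose h := Num.min (e / B) (2^-1 * \sum_i `|u ord0 i|).
have h0 : 0 < h by rewrite lt_min divr_gt0//= mulr_gt0// invr_gt0.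
have [q qu] := ratr_rV_dense u h0.
have Bh : B * \sum_i `|(u - ratr_rV q) ord0 i| <= e.
  by rewrite mulrC -ler_pdivlMr// (le_trans qu)// ge_min lexx.
have q0 : ratr_rV q != 0.
  apply: contraTN qu => /eqP ->; rewrite subr0 -ltNge gt_min; apply/orP; right.
  by rewrite gtr_pMl// invf_lt1// ltr1n.
have [N qN] := mem_rational_dirs q0.
rewrite -[u in dotv x u](subrK (ratr_rV q)) dotvDr addrC lerD//; last first.
  by rewrite (le_trans (ler_norm _))// (le_trans (norm_dotv_le _ xB)).
rewrite (le_trans (ler_norm _))// (le_trans (xcuts N _ qN))//.
have qu' : \sum_i `|(ratr_rV q - u) ord0 i| = \sum_i `|(u - ratr_rV q) ord0 i|.
  by apply: eq_bigr => i _; rewrite -opprB mxE normrN.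
have hK0 := ltW (support_fun_gt0 bK q0).
have hL0 := ltW (support_fun_gt0 bL q0).
rewrite le_geomean//.
  rewrite (le_trans (support_fun_Lipschitz (ratr_rV q) u KB (ne _ bK)))//.
  by rewrite qu' lerD2l.
rewrite (le_trans (support_fun_Lipschitz (ratr_rV q) u LB (ne _ bL)))//.
by rewrite qu' lerD2l.
Qed.

(** The box of half-width [B] is the ambient body; the polytopes cut out of it
by the supporting slabs of [K] and [L] contain [K] and [L], and the polytopes
cut out by the geometric means of the widths decrease into the logarithmic
combination. *)
Lemma log_BM_of_cut_log_concave l (K L : set 'rV[R]_n) :
  (forall s : seq 'rV[R]_n, cut_log_concave s) -> 0 < l < 1 ->
  symmetric_convex_body K -> symmetric_convex_body L ->
  log_Brunn_Minkowski l K L.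
Proof.
move=> cutP l01 bK bL.
have [_ [B1 B10 KB1] _ _ _] := (symmetric_convex_bodyP K).1 bK.
have [_ [B2 B20 LB2] _ _ _] := (symmetric_convex_bodyP L).1 bL.
pose B := Num.max B1 B2.
have B0 : 0 < B by rewrite lt_max B10.
have KB : K `<=` box (fun=> B).
  by move=> x /KB1 xB i; rewrite (le_trans (xB i))// le_max lexx.
have LB : L `<=` box (fun=> B).
  by move=> x /LB2 xB i; rewrite (le_trans (xB i))// le_max lexx orbT.
pose h u := geomean l (support_fun K u) (support_fun L u).
pose M N := box (fun=> B) `&` cuts (rational_dirs N) h.
have cM N (f : 'rV[R]_n -> R) :
    closed (box (fun=> B) `&` cuts (rational_dirs N) f).
  by apply: closedI; [exact: closed_box|exact: closed_cuts].
have sub_cuts (A : set 'rV[R]_n) N : A `<=` box (fun=> B) ->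
    A = [set - x | x in A] ->
    A `<=` box (fun=> B) `&` cuts (rational_dirs N) (support_fun A).
  move=> AB symA x Ax; split=> [|u _]; first exact: AB.
  rewrite ler_norml lerNl -dotvNl; apply/andP; split.
    by apply: (support_fun_ge _ AB); rewrite symA; exists x.
  exact: (support_fun_ge _ AB).
have mono (A A' : set 'rV[R]_n) : closed A -> closed A' -> A `<=` A' ->
    (lebesgue_rV R n A <= lebesgue_rV R n A')%E.
  by move=> cA cA' AA'; apply: le_measure; rewrite ?inE//;
    exact: closed_measurable_rV.
have volM N : (lebesgue_rV R n K `^ l * lebesgue_rV R n L `^ (1 - l)%R <=
    lebesgue_rV R n (M N))%E.
  have pos (A : set 'rV[R]_n) : symmetric_convex_body A ->
      forall u, u \in rational_dirs N -> 0 < support_fun A u.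
    by move=> bA u /rational_dirs_neq0; exact: support_fun_gt0.
  have bB : symmetric_convex_body (box (fun=> B) : set 'rV[R]_n).
    exact: symmetric_convex_body_box.
  have := cutP _ _ _ _ _ _ l bB (fun=> B0) (fun=> B0) (pos K bK) (pos L bL) l01.
  rewrite (_ : (fun i : 'I_n => geomean l B B) = fun=> B); last first.
    by rewrite geomeanxx// ltW.
  rewrite !setIid; apply: le_trans.
  apply: le_poweR_geomean => //.
    apply: mono => //; first exact: symmetric_convex_body_closed.
    by apply: sub_cuts => //; case: bK.
  apply: mono => //; first exact: symmetric_convex_body_closed.
  by apply: sub_cuts => //; case: bL.
apply: (@le_trans _ _ (lebesgue_rV R n (\bigcap_N M N))).
  apply: (@lebesgue_rV_bigcap_ge _ _ _ B) => // [N|x []//|N x [xB xM]].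
    exact: cM.
  by split=> // u uN; apply: xM; exact: rational_dirs_sub.
apply: mono; [|exact: closed_log_comb|].
  by apply: closed_bigI => N _; exact: cM.
move=> x xM; apply: (log_comb_of_rational_dirs l01 bK bL B0 KB LB).
  by have [] := xM 0%N I.
by move=> N; have [] := xM N I.
Qed.

End density.

(** * The two implications *)

Theorem theorem1p5 (R : realType) :
  ((forall n : nat, (0 < n)%N ->
      B_property (uniform_measure (measurable_cube R n))) ->
   forall n : nat, (0 < n)%N -> forall l : R, 0 < l < 1 ->
     forall K L : set 'rV[R]_n,
       symmetric_convex_body K -> symmetric_convex_body L ->
       log_Brunn_Minkowski l K L) /\
  (forall n : nat, (0 < n)%N ->
     (forall l : R, 0 <= l <= 1 -> forall K L : set 'rV[R]_n,
        symmetric_convex_body K -> symmetric_convex_body L ->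
        log_Brunn_Minkowski l K L) ->
     B_property (uniform_measure (measurable_cube R n))).
Proof.
split=> [BP n n0 l l01 K L bK bL|n n0 BM].
  apply: log_BM_of_cut_log_concave => // s.
  apply: cut_log_concave_all => // m m0.
  by apply/B_property_cubeP; exact: BP.
by apply/B_property_cubeP; exact: box_log_concave_of_log_BM.
Qed.
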